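(* Let $k\ge 2$. Let nodes $z_1,\dots,z_k\in\mathbb{C}$, weight vectors $\bm w_1,\dots,\bm w_k\in\mathbb{C}^2$, poles $p_1,\dots,p_k\in\overline{\mathbb{C}}$ and indices $\pi_1,\dots,\pi_k\in\{1,2\}$ be IEP data of dimension $k$, and let $\{(H,K),Q\}$ be a solution of the corresponding inverse eigenvalue problem (IEP) of dimension $k$. Let an additional node $z_{k+1}$, weight vector $\bm w_{k+1}$, pole $p_{k+1}$ and index $\pi_{k+1}$ be given such that the extended collection is IEP data of dimension $k+1$. Then the IEP of dimension $k+1$ has a solution $\{(\widehat H,\widehat K),\widehat Q\}$ which can be written as $$(\widehat H,\widehat K)=Q_L\left(\begin{bmatrix}H&\\&z_{k+1}\end{bmatrix},\begin{bmatrix}K&\\&1\end{bmatrix}\right)Q_R,\qquad \widehat Q=\begin{bmatrix}Q&\\&1\end{bmatrix}Q_L^H,$$ where $Q_L,Q_R\in\mathbb{C}^{(k+1)\times(k+1)}$ are products of rotations.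
   Context: Notation: $\overline{\mathbb{C}}=\mathbb{C}\cup\{\infty\}$; $\cdot^H$ is the conjugate transpose; $\bm e_i$ are standard basis vectors. A pencil $(H,K)$ is a pair of square matrices of the same size, and $X(H,K)Y=(XHY,XKY)$. A matrix $(m_{ij})$ is 2-Hessenberg if $m_{ij}=0$ for $i>j+2$; a pencil is 2-Hessenberg if both of its matrices are. A rotation $G_{i,j}$ ($i<j$) of size $n$ is the $n\times n$ matrix equal to the identity except that its entries at positions $(i,i),(i,j),(j,i),(j,j)$ are $\bar c,-\bar s,s,c$ respectively, with $s,c\in\mathbb{C}$, $|c|^2+|s|^2=1$. Rational function vectors. Given poles $p_1,\dots,p_n\in\overline{\mathbb{C}}$ with $p_1=p_2=\infty$ and indices $\pi_1,\dots,\pi_n\in\{1,2\}$ with $\pi_1=1,\pi_2=2$, where finite poles with the same index are pairwise distinct, define $\bm v_i\in\mathbb{C}(z)^2$ as follows: the component of $\bm v_i$ other than the $\pi_i$-th is $0$, and the $\pi_i$-th component is $1/(z-p_i)$ if $p_i\in\mathbb{C}$, and $z^\ell$ if $p_i=\infty$, where $\ell=\#\{m<i: p_m=\infty,\ \pi_m=\pi_i\}$. Thus $\bm v_1=[1,0]^T$, $\bm v_2=[0,1]^T$. Set $\mathcal{R}_0=\{0\}$ and $\mathcal{R}_i=\operatorname{span}_{\mathbb{C}}\{\bm v_1,\dots,\bm v_i\}$. IEP data of dimension $n\ge2$: nodes $z_1,\dots,z_n\in\mathbb{C}$, nonzero weight vectors $\bm w_1,\dots,\bm w_n\in\mathbb{C}^2$,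 poles $p_1,\dots,p_n\in\overline{\mathbb{C}}$ with $p_1=p_2=\infty$ and indices $\pi_1,\dots,\pi_n\in\{1,2\}$ with $\pi_1=1,\pi_2=2$, where finite poles with the same index are pairwise distinct, such that $z_i\ne p_m$ for all $i,m$, and such that $\langle\bm\phi,\bm\psi\rangle_{\mathcal{R}_n}=\sum_{i=1}^n\bm\psi(z_i)^H\bm w_i\bm w_i^H\bm\phi(z_i)$ is positive definite on $\mathcal{R}_n$ (i.e. no nonzero $\bm\phi\in\mathcal{R}_n$ satisfies $\bm w_i^H\bm\phi(z_i)=0$ for all $i=1,\dots,n$). Put $Z=\operatorname{diag}(z_1,\dots,z_n)$ and let $W\in\mathbb{C}^{n\times2}$ be the matrix with rows $\bm w_1^H,\dots,\bm w_n^H$. IEP of dimension $n$: a solution consists of a 2-Hessenberg pencil $(H,K)$ and a unitary $Q$, all in $\mathbb{C}^{n\times n}$, such that (D1) $ZQK=QH$; (D2) $W=Q[\bm e_1\ \bm e_2]R$ for some upper triangular $R\in\mathbb{C}^{2\times2}$; (D3) $p_{i+2}=h_{i+2,i}/k_{i+2,i}$ for $i=1,\dots,n-2$ (the numerator and denominator are not both zero, and the ratio is $\infty$ if $k_{i+2,i}=0$); (D4) the rational function vectors $\bm\phi_1,\dots,\bm\phi_n$ generated by $(H,K)$, namely $[\bm\phi_1\ \bm\phi_2]=R^{-1}$ and $$(zk_{j+2,j}-h_{j+2,j})\bm\phi_{j+2}(z)=-\sum_{i=1}^{j+1}(zk_{ij}-h_{ij})\bm\phi_i(z),\qquad j=1,\dots,n-2,$$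 satisfy $\bm\phi_i\in\mathcal{R}_i\setminus\mathcal{R}_{i-1}$ for $i=1,\dots,n$.
   Formalization: The formal theorem also assumes that the given pencil (H,K) is regular, i.e. det(zK−H) is not identically zero (and proves the new pencil regular); without it the claim fails, e.g. for k=2, nodes 0,0, weights e_1,e_2, H=K=0, Q=I, extended by z_3=1, w_3=e_1, p_3=∞, π_3=1. *)

(* Defs.v *)
From HB Require Import structures.
From mathcomp Require Import all_boot all_order all_algebra.
From mathcomp Require Import fraction spectral.
From mathcomp Require Import reals complex.

Set Implicit Arguments.
Unset Strict Implicit.
Unset Printing Implicit Defensive.

Import Order.TTheory GRing.Theory Num.Theory.
Local Open Scope ring_scope.
Local Open Scope quotient_scope.
Local Open Scope sesquilinear_scope.

(* All indices are shifted down by one: 1, ..., n become 'I_n and the component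
   indices {1, 2} become 'I_2. *)

Section RationalFunctions.
Variable C : fieldType.

Definition ratfun := {fraction {poly C}}.

Definition ratfunC (c : C) : ratfun := FracField.tofrac c%:P.

(* Value at z of the fraction in lowest terms; ratfun_evalE shows that the
   representative does not matter. At a pole this is 0, by 0^-1 = 0. *)
Definition ratfun_eval (f : ratfun) (z : C) : C :=
  let a := \n_(repr f) in
  let b := \d_(repr f) in
  let g := gcdp a b in
  (a %/ g).[z] / (b %/ g).[z].

Lemma ratfun_evalE (a b : {poly C}) (z : C) : b.[z] != 0 ->
  ratfun_eval (FracField.tofrac a / FracField.tofrac b) z = a.[z] / b.[z].
Proof.
move=> bz; rewrite /ratfun_eval; set f := (X in repr X).
have b0 : b != 0 by apply: contraNneq bz => ->; rewrite horner0.
set r := repr f; set g := gcdp _ _.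
have d0 : \d_r != 0 := denom_ratioP r.
have g0 : g != 0 by rewrite gcdp_eq0 negb_and d0 orbT.
have rE : f = FracField.tofrac \n_r / FracField.tofrac \d_r.
  rewrite -[LHS]reprK -/r -{1}[r]Ratio_numden !piE.
  rewrite /FracField.mulf /FracField.invf.
  by rewrite !numden_Ratio ?oner_neq0 // mulr1 mul1r.
have nE : \n_r * b = a * \d_r.
  apply/eqP; rewrite -tofrac_eq !tofracM.
  by rewrite -eqr_div ?tofrac_eq0 // -rE.
have qE : (\n_r %/ g) * b = a * (\d_r %/ g).
  apply: (mulIf g0); rewrite mulrAC -[RHS]mulrA.
  by rewrite (divpK (dvdp_gcdl _ _)) (divpK (dvdp_gcdr _ _)).
have cop : coprimep (\n_r %/ g) (\d_r %/ g).
  by rewrite coprimep_div_gcd // d0 orbT.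
have dz : (\d_r %/ g).[z] != 0.
  apply/negP => dz0; have: (\d_r %/ g) %| b.
    by rewrite -(Gauss_dvdpr _ (_ : coprimep _ (\n_r %/ g))) 1?coprimep_sym //
               qE dvdp_mull.
  case/dvdpP => q bE; move: bz.
  by rewrite bE hornerM (eqP dz0) mulr0 eqxx.
by apply/eqP; rewrite eqr_div // -!hornerM qE.
Qed.

End RationalFunctions.

Section IEP.
Variable C : numClosedFieldType.

(* A pole is an element of C together with infinity, which is None. *)
Record iep_data (n : nat) := IepData {
  node : 'I_n -> C;
  weight : 'I_n -> 'cV[C]_2;
  pole : 'I_n -> option C;
  pidx : 'I_n -> 'I_2
}.

Definition snoc_fun (T : Type) (n : nat) (f : 'I_n -> T) (x : T)
    (i : 'I_(n + 1)) : T :=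
  match split i with inl j => f j | inr _ => x end.

Definition iep_extend (n : nat) (d : iep_data n)
    (z : C) (w : 'cV[C]_2) (p : option C) (q : 'I_2) : iep_data (n + 1) :=
  IepData (snoc_fun (node d) z) (snoc_fun (weight d) w)
          (snoc_fun (pole d) p) (snoc_fun (pidx d) q).

Section Spaces.
Variables (n : nat) (d : iep_data n).

(* The exponent l in z^l for the i-th pole, when that pole is infinite. *)
Definition infty_rank (i : 'I_n) : nat :=
  #|[set m : 'I_n | [&& (m < i)%N, pole d m == None & pidx d m == pidx d i]]|.

Definition basis_vec (i : 'I_n) : 'cV[ratfun C]_2 :=
  \col_j (if j == pidx d i then
            match pole d i with
            | Some p => (FracField.tofrac ('X - p%:P))^-1
            | None => FracField.tofrac 'X^(infty_rank i)
            end
          else 0).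

Definition in_Rspace (i : nat) (phi : 'cV[ratfun C]_2) : Prop :=
  exists a : 'I_n -> C,
    phi = \sum_(m < n | (m < i)%N) ratfunC (a m) *: basis_vec m.

Definition vec_eval (phi : 'cV[ratfun C]_2) (z : C) : 'cV[C]_2 :=
  map_mx (fun f => ratfun_eval f z) phi.

Definition Rform (phi psi : 'cV[ratfun C]_2) : C :=
  \sum_(i < n) ((vec_eval psi (node d i))^t* *m weight d i
                *m (weight d i)^t* *m vec_eval phi (node d i)) 0 0.

Definition is_iep_data : Prop :=
  (2 <= n)%N /\
  [/\ forall i, weight d i != 0,
      forall i : 'I_n, (i < 2)%N -> pole d i = None /\ pidx d i = i :> nat,
      forall i m : 'I_n, i != m -> pidx d i = pidx d m -> pole d i != None ->
        pole d i != pole d m,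
      forall i m, pole d m != Some (node d i)
    & forall phi, in_Rspace n phi -> phi != 0 -> 0 < Rform phi phi].

Definition node_mx : 'M[C]_n := diag_mx (\row_i node d i).

Definition weight_mx : 'M[C]_(n, 2) := \matrix_(i, j) (weight d i)^t* 0 j.

End Spaces.

Definition hessenberg2 (n : nat) (M : 'M[C]_n) : Prop :=
  forall i j : 'I_n, (j + 2 < i)%N -> M i j = 0.

(* Kept apart from iep_solution.  The clauses of iep_solution do not make the
   nodes the eigenvalues of (H, K): for n = 2 the zero pencil satisfies them.
   Given node_mx d *m Q *m K = Q *m H, regularity amounts to invertibility
   of K. *)
Definition regular_pencil (n : nat) (H K : 'M[C]_n) : Prop :=
  exists z : C, \det (z *: K - H) != 0.

Definition generated (n : nat) (H K : 'M[C]_n) (R : 'M[C]_2)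
    (phi : 'I_n -> 'cV[ratfun C]_2) : Prop :=
  let P i j : ratfun C := FracField.tofrac (K i j *: 'X - (H i j)%:P) in
  (forall (i : 'I_n) (j : 'I_2), i = j :> nat ->
     phi i = map_mx (@ratfunC C) (col j (invmx R))) /\
  (forall l j : 'I_n, l = (j + 2)%N :> nat ->
     P l j *: phi l = - \sum_(i < n | (i < l)%N) P i j *: phi i).

(* pid_mx 2 is the n x 2 matrix [e_1 e_2].  The condition R \in unitmx only
   makes R^-1 meaningful: for IEP data the matrix W has rank 2, so it follows
   from W = Q [e_1 e_2] R.  The recurrence determines phi uniquely, because its
   left-hand factors are nonzero polynomials by the preceding clause. *)
Definition iep_solution (n : nat) (d : iep_data n) (H K Q : 'M[C]_n) : Prop :=
  [/\ hessenberg2 H, hessenberg2 K & Q \is unitarymx] /\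
  exists R : 'M[C]_2,
  [/\ node_mx d *m Q *m K = Q *m H,
      [/\ is_trig_mx R^T, R \in unitmx &
          weight_mx d = Q *m (pid_mx 2 : 'M[C]_(n, 2)) *m R],
      forall l j : 'I_n, l = (j + 2)%N :> nat ->
        (H l j, K l j) != (0, 0) /\
        pole d l = (if K l j == 0 then None else Some (H l j / K l j))
    & exists phi : 'I_n -> 'cV[ratfun C]_2, generated H K R phi /\
        forall i : 'I_n, in_Rspace d i.+1 (phi i) /\ ~ in_Rspace d i (phi i)].

Definition rotation (n : nat) (G : 'M[C]_n) : Prop :=
  exists (i j : 'I_n) (s c : C),
    [/\ (i < j)%N, `|c| ^+ 2 + `|s| ^+ 2 = 1 &
        G = \matrix_(a, b)
              (if (a == i) && (b == i) then c^*
               else if (a == i) && (b == j) then - s^*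
               else if (a == j) && (b == i) then s
               else if (a == j) && (b == j) then c
               else (a == b)%:R)].

Definition rotation_product (n : nat) (M : 'M[C]_n) : Prop :=
  exists Gs : seq 'M[C]_n,
    (forall G, G \in Gs -> rotation G) /\ M = \big[mulmx/1%:M]_(G <- Gs) G.

End IEP.

(* Main.v *)
From HB Require Import structures.
Require Import Defs.
From mathcomp Require Import all_boot all_order all_algebra.
From mathcomp Require Import fraction spectral.
From mathcomp Require Import reals complex.
From mathcomp Require Import perm ring.

Set Implicit Arguments.
Unset Strict Implicit.
Unset Printing Implicit Defensive.

Import Order.TTheory GRing.Theory Num.Theory.
Local Open Scope ring_scope.
Local Open Scope sesquilinear_scope.

(* Of the old solution only regularity, unitarity and Z Q K = Q H matter: they
   make (A, B) = (diag(H, z_(k+1)), diag(K, 1)) a pencil with B invertible and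
   Z Q B = Q A, for the extended Z and for Q extended by 1.

   Let E be the matrix of values w_i^H v_m(z_i).  Positive definiteness and the
   independence of the v_m make E invertible.  Rotating Q^H E to an upper
   triangular U by a product P of rotations gives E = (Q P^H) U, so Q P^H
   holds the values of the orthonormal functions V U^-1.  In the basis v_m the
   recurrence is explicit: each v_l with l > 2 is reached from some v_m, the
   previous power of z if p_l is infinite and v_l itself if p_l is finite.  As
   l varies these v_m are distinct, so the corresponding K is a permutation
   matrix, and the last two columns are free.  Right multiplication of the
   pencil by an upper triangular matrix changes neither the Hessenberg ratios
   nor the functions generated; this freedom turns the pencil into
   (P A G, P B G) with G again a product of rotations. *)

(** * Rotations and triangularization *)

Section Triangular.
Variable F : fieldType.

(** Split off the first row and column: the inverse of a block lower triangular matrix is explicit,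
    with the inverses of the diagonal blocks on its diagonal. *)
Lemma trig_mx_inv n (A : 'M[F]_n) :
  is_trig_mx A -> A \in unitmx -> is_trig_mx (invmx A).
Proof.
move=> tA; elim/trigsqmx_ind: n A / tA => [|n a c A tA IHn] uM.
  by rewrite [invmx 0]flatmx0 mx0_is_trig.
have [uA ua] : A \in unitmx /\ a \in unitmx.
  by move: uM; rewrite !unitmxE det_lblock unitrM => /andP[].
suff -> : invmx (block_mx a 0 c A)
    = block_mx (invmx a) 0 (- (invmx A *m c *m invmx a)) (invmx A).
  by rewrite (@is_trig_block_mx _ 1 n 1 n) // eqxx mx11_is_trig IHn.
rewrite -[RHS](mulmxK uM) mulmx_block.
rewrite !mul0mx !mulmx0 !addr0 !add0r mulNmx !mulmxKV ?mulVmx // addNr.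
by rewrite -scalar_mx_block mul1mx.
Qed.

Lemma trig_mx_diag_neq0 n (A : 'M[F]_n) i :
  is_trig_mx A -> A \in unitmx -> A i i != 0.
Proof.
move=> tA; rewrite unitmxE det_trig // unitfE => /prodf_neq0; exact.
Qed.

End Triangular.

Section Rotations.
Variable C : numClosedFieldType.

Lemma rotation_product1 n : rotation_product (1%:M : 'M[C]_n).
Proof. by exists [::]; split => //; rewrite big_nil. Qed.

Lemma rotation_productM n (A B : 'M[C]_n) :
  rotation_product A -> rotation_product B -> rotation_product (A *m B).
Proof.
move=> [s [sP ->]] [t [tP ->]]; exists (s ++ t); split.
  by move=> G; rewrite mem_cat => /orP[/sP|/tP].
elim: s {sP} => [|G s IHs]; first by rewrite big_nil mul1mx.
by rewrite !big_cons -IHs mulmxA.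
Qed.

Lemma rotation_block n (G : 'M[C]_n) :
  rotation G -> rotation (block_mx 1%:M 0 0 G : 'M_(1 + n)).
Proof.
move=> [i [j [s [c [ltij sc ->]]]]].
exists (rshift 1 i), (rshift 1 j), s, c; split => //.
apply/matrixP => a b; rewrite [RHS]mxE.
case: (split_ordP a) => {}a ->; case: (split_ordP b) => {}b ->.
- by rewrite block_mxEul !ord1 mxE /=.
- by rewrite block_mxEur !ord1 mxE /=.
- by rewrite block_mxEdl !ord1 mxE /= !andbF.
- by rewrite block_mxEdr mxE !(inj_eq (@rshift_inj _ _)).
Qed.

Lemma rotation_product_block n (P : 'M[C]_n) :
  rotation_product P -> rotation_product (block_mx 1%:M 0 0 P : 'M_(1 + n)).
Proof.
move=> [s [sP ->]].
exists [seq (block_mx 1%:M 0 0 B : 'M_(1 + n)) | B <- s]; split.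
  by move=> _ /mapP[A /sP rA ->]; apply: rotation_block.
elim: s {sP} => [|A s IHs]; first by rewrite !big_nil -scalar_mx_block.
rewrite big_cons /= big_cons -IHs mulmx_block.
by rewrite !mul0mx !mulmx0 !mul1mx !addr0 add0r.
Qed.

(** The adjoint is recorded as well because the right factor of the update is the adjoint of a
    triangularizing product. *)
Definition rotation_unitary n (P : 'M[C]_n) : Prop :=
  [/\ rotation_product P, rotation_product (P^t*) & P \is unitarymx].

Lemma conjtr_block m1 m2 n1 n2 (A : 'M[C]_(m1, n1)) (B : 'M_(m1, n2))
    (E : 'M_(m2, n1)) (G : 'M_(m2, n2)) :
  (block_mx A B E G)^t* = block_mx (A^t*) (E^t*) (B^t*) (G^t*).
Proof. by rewrite tr_block_mx map_block_mx. Qed.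

Lemma conjtr0 m n : (0 : 'M[C]_(m, n))^t* = 0.
Proof. by rewrite trmx0 map_mx0. Qed.

Lemma conjtr1 n : (1%:M : 'M[C]_n)^t* = 1%:M.
Proof. by rewrite trmx1 map_mx1. Qed.

Lemma conjtrM m n p (A : 'M[C]_(m, n)) (B : 'M_(n, p)) :
  (A *m B)^t* = B^t* *m A^t*.
Proof. by rewrite trmx_mul map_mxM. Qed.

Lemma unitarymxPC n (P : 'M[C]_n) : P \is unitarymx -> P^t* *m P = 1%:M.
Proof. by rewrite -trmxC_unitary => /unitarymxP; rewrite trmxCK. Qed.

Lemma unitarymx_block m n (A : 'M[C]_m) (B : 'M[C]_n) :
  A \is unitarymx -> B \is unitarymx ->
  block_mx A 0 0 B \is unitarymx.
Proof.
move=> /unitarymxP uA /unitarymxP uB; apply/unitarymxP.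
rewrite conjtr_block !conjtr0 mulmx_block !mul0mx !mulmx0 !addr0 add0r uA uB.
by rewrite -scalar_mx_block.
Qed.

Lemma unitarymx1 n : (1%:M : 'M[C]_n) \is unitarymx.
Proof. by apply/unitarymxP; rewrite conjtr1 mulmx1. Qed.

Lemma rotation_unitary1 n : rotation_unitary (1%:M : 'M[C]_n).
Proof.
by split; rewrite ?conjtr1 ?unitarymx1 //; apply: rotation_product1.
Qed.

Lemma rotation_unitaryM n (A B : 'M[C]_n) :
  rotation_unitary A -> rotation_unitary B -> rotation_unitary (A *m B).
Proof.
move=> [rA rA' uA] [rB rB' uB]; split; rewrite ?conjtrM ?mul_unitarymx //;
  exact: rotation_productM.
Qed.

Lemma rotation_unitary_block n (G : 'M[C]_n) :
  rotation_unitary G -> rotation_unitary (block_mx 1%:M 0 0 G : 'M_(1 + n)).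
Proof.
move=> [rG rG' uG]; split; first exact: rotation_product_block.
  by rewrite conjtr_block !conjtr0 conjtr1; apply: rotation_product_block.
by rewrite unitarymx_block ?unitarymx1.
Qed.

Definition rot2 (s c : C) : 'M[C]_2 :=
  \matrix_(a, b) if a == 0 then (if b == 0 then c^* else - s^*)
                 else (if b == 0 then s else c).

(** A rotation of the first two coordinates. Planes further down are reached by bordering with
    [rotation_unitary_block]. *)
Definition givens n (s c : C) : 'M[C]_(2 + n) :=
  block_mx (rot2 s c) 0 0 1%:M.

Lemma conjtr_rot2 (s c : C) : (rot2 s c)^t* = rot2 (- s) c^*.
Proof.
apply/matrixP => a b; rewrite !mxE.
by case: (a == 0); case: (b == 0); rewrite ?rmorphN /= ?conjCK ?opprK.
Qed.

Lemma rot2_unitary (s c : C) : `|c| ^+ 2 + `|s| ^+ 2 = 1 ->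
  rot2 s c \is unitarymx.
Proof.
rewrite !normCK => sc; apply/unitarymxP; rewrite conjtr_rot2.
apply/matrixP => a b; rewrite !mxE !big_ord_recl big_ord0 !mxE /=.
case: (unliftP 0 a) => [{}a|] ->; case: (unliftP 0 b) => [{}b|] ->;
  rewrite ?ord1 /= ?rmorphN /= ?conjCK; first [ring|rewrite -sc; ring].
Qed.

Lemma givens_unitary n (s c : C) : `|c| ^+ 2 + `|s| ^+ 2 = 1 ->
  givens n s c \is unitarymx.
Proof. by move=> sc; rewrite unitarymx_block ?rot2_unitary ?unitarymx1. Qed.

Lemma conjtr_givens n (s c : C) : (givens n s c)^t* = givens n (- s) c^*.
Proof. by rewrite conjtr_block !conjtr0 conjtr1 conjtr_rot2. Qed.

Lemma givens_rotation n (s c : C) : `|c| ^+ 2 + `|s| ^+ 2 = 1 ->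
  rotation (givens n s c).
Proof.
move=> sc; exists (lshift n 0), (lshift n 1), s, c; split => //.
apply/matrixP => a b; rewrite [RHS]mxE.
case: (split_ordP a) => {}a ->; case: (split_ordP b) => {}b ->.
- rewrite block_mxEul !mxE !(inj_eq (@lshift_inj _ _)).
  by case: (unliftP 0 a) => [{}a|] ->; case: (unliftP 0 b) => [{}b|] ->;
    rewrite ?ord1.
- by rewrite block_mxEur mxE !eq_rlshift !andbF eq_lrshift.
- by rewrite block_mxEdl mxE !eq_rlshift.
- by rewrite block_mxEdr mxE !eq_rlshift (inj_eq (@rshift_inj _ _)).
Qed.

Lemma givens_rotation_unitary n (s c : C) : `|c| ^+ 2 + `|s| ^+ 2 = 1 ->
  rotation_unitary (givens n s c).
Proof.
have rp (t d : C) : `|d| ^+ 2 + `|t| ^+ 2 = 1 ->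
    rotation_product (givens n t d).
  move=> td; exists [:: givens n t d]; split.
    by move=> G; rewrite inE => /eqP ->; apply: givens_rotation.
  by rewrite big_cons big_nil mulmx1.
move=> sc; split; [exact: rp| |exact: givens_unitary].
by rewrite conjtr_givens; apply: rp; rewrite norm_conjC normrN.
Qed.

Lemma rotate_pair (a b : C) :
  exists s c : C, `|c| ^+ 2 + `|s| ^+ 2 = 1 /\ s * a + c * b = 0.
Proof.
set r2 := `|a| ^+ 2 + `|b| ^+ 2.
have [r0|r_neq0] := eqVneq r2 0.
  exists 0, 1; rewrite normr0 normr1 expr0n expr1n addr0; split => //.
  have /andP[_ /eqP] : (`|a| ^+ 2 == 0) && (`|b| ^+ 2 == 0).
    by rewrite -paddr_eq0 ?exprn_ge0 // -/r2 r0.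
  by move/eqP; rewrite expf_eq0 normr_eq0 => /eqP ->; rewrite mul0r mulr0 addr0.
have r_ge0 : 0 <= r2 by rewrite addr_ge0 ?exprn_ge0.
exists (- b / sqrtC r2), (a / sqrtC r2); split; last by ring.
rewrite !normrM !normfV !exprMn !exprVn normrN -mulrDl.
by rewrite (ger0_norm (_ : 0 <= sqrtC r2)) ?sqrtC_ge0 // sqrtCK divff.
Qed.

(** Elimination runs from the bottom up: the tail is first reduced to its leading entry by
    induction, and one rotation of the first two coordinates then removes that entry. *)
Lemma rotate_column n (x : 'cV[C]_(1 + n)) :
  exists2 P : 'M[C]_(1 + n), rotation_unitary P & dsubmx (P *m x) = 0.
Proof.
elim: n x => [|n IHn] x.
  by exists 1%:M; [exact: rotation_unitary1|rewrite flatmx0].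
have [P rP] := IHn (dsubmx x).
set y := P *m _ => y0.
have [s [c [sc sc0]]] := rotate_pair (x 0 0) (y 0 0).
exists (givens n s c *m (block_mx 1%:M 0 0 P : 'M_(1 + n.+1))).
  by apply: rotation_unitaryM (givens_rotation_unitary _ sc)
            (rotation_unitary_block rP).
set u := usubmx x; set v := usubmx y; rewrite -mulmxA.
have -> : (block_mx 1%:M 0 0 P : 'M_(1 + n.+1)) *m x = col_mx u (col_mx v 0).
  rewrite -[x](@vsubmxK _ 1 n.+1) (@mul_block_col _ 1 n.+1 1 n.+1).
  rewrite !mul0mx mul1mx addr0 add0r.
  by rewrite -[in RHS]y0 vsubmxK.
have -> : col_mx u (col_mx v 0) = col_mx (col_mx u v) 0 :> 'M_(2 + n, 1).
  by rewrite col_mxA; apply: castmx_id.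
rewrite /givens (@mul_block_col _ 2 n 2 n) !mul0mx !mulmx0 !addr0.
have uv0 : col_mx u v 0 0 = x 0 0.
  rewrite mxE; case: splitP => k //= _.
  by rewrite mxE !ord1; congr (x _ _); apply: val_inj.
have uv1 : col_mx u v 1 0 = y 0 0.
  rewrite mxE; case: splitP => k /= kE; first by move: (ltn_ord k); rewrite -kE.
  by rewrite mxE !ord1; congr (y _ _); apply: val_inj.
(* Row 1 is the second row of the rotated pair and vanishes by [sc0]; the rows below it were already
   zero. *)
apply/matrixP => i j; rewrite !ord1 [RHS]mxE [LHS]mxE.
case: (split_ordP (rshift 1 i : 'I_(2 + n))) => a ia; rewrite ia.
  rewrite (@col_mxEu _ 2 n 1); have {ia}-> : a = 1.
    apply: val_inj; have /= := congr1 val ia; rewrite add1n => ia'.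
    by move: (ltn_ord a); rewrite -[val a]ia'; case: (i : nat).
  rewrite mxE !big_ord_recl big_ord0 !ord1 uv0.
  rewrite (_ : lift ord0 0 = 1) ?uv1; last exact: val_inj.
  by move: sc0; rewrite !mxE /= addr0.
by rewrite (@col_mxEd _ 2 n 1) mxE.
Qed.

(** QR factorization: clear the first column, then recurse on the lower right block, which leaves
    the first row alone. *)
Lemma rotate_triangular n (A : 'M[C]_n) :
  exists2 P : 'M[C]_n, rotation_unitary P & is_trig_mx (P *m A)^T.
Proof.
elim: n A => [|n IHn] A.
  exists 1%:M; [exact: rotation_unitary1|].
  by rewrite mul1mx [A^T]flatmx0 mx0_is_trig.
have [P1 rP1] := rotate_column (lsubmx (A : 'M_(1 + n))).
set B : 'M_(1 + n) := P1 *m A => B0.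
have [P2 rP2 tP2] := IHn (drsubmx B).
exists (block_mx 1%:M 0 0 P2 *m P1 : 'M_(1 + n)).
  exact: rotation_unitaryM (rotation_unitary_block rP2) rP1.
rewrite -mulmxA -/B -[B]submxK.
have -> : dlsubmx B = 0.
  by apply/matrixP => i j; rewrite -B0 !mxE; apply: eq_bigr => m _; rewrite mxE.
rewrite (@mulmx_block _ 1 n 1 n 1 n) !mul0mx !mulmx0 !mul1mx !addr0 !add0r.
rewrite (@tr_block_mx _ 1 n 1 n) trmx0 (@is_trig_block_mx _ 1 n 1 n) //.
by rewrite eqxx mx11_is_trig.
Qed.
End Rotations.

(** * Values of the basis functions *)

Section RationalValues.
Variable C : fieldType.

Lemma ratfunC_is_zmod_morphism : zmod_morphism (@ratfunC C).
Proof. by move=> a b; rewrite /ratfunC !rmorphB. Qed.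

Lemma ratfunC_is_monoid_morphism : monoid_morphism (@ratfunC C).
Proof. by split=> [|a b]; rewrite /ratfunC ?rmorphM // !rmorph1. Qed.

HB.instance Definition _ := GRing.isZmodMorphism.Build C (ratfun C) (@ratfunC C)
  ratfunC_is_zmod_morphism.
HB.instance Definition _ := GRing.isMonoidMorphism.Build C (ratfun C)
  (@ratfunC C) ratfunC_is_monoid_morphism.

(** A relation that holds only where f is regular at z. The function [ratfun_eval] takes the value 0
    at poles, so it is neither additive nor multiplicative; the relation is compatible with both
    operations. *)
Definition value_at (f : ratfun C) (z v : C) : Prop :=
  exists a b : {poly C}, [/\ b.[z] != 0,
    f = FracField.tofrac a / FracField.tofrac b & v = a.[z] / b.[z]].

Lemma value_at_eval f z v : value_at f z v -> ratfun_eval f z = v.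
Proof. by move=> [a [b [bz -> ->]]]; apply: ratfun_evalE. Qed.

Lemma value_at_poly (a : {poly C}) z : value_at (FracField.tofrac a) z a.[z].
Proof. by exists a, 1; rewrite tofrac1 hornerC oner_neq0 !divr1. Qed.

Lemma value_at_inv (a : {poly C}) z : a.[z] != 0 ->
  value_at (FracField.tofrac a)^-1 z a.[z]^-1.
Proof. by move=> az; exists 1, a; rewrite tofrac1 hornerC !div1r. Qed.

Lemma value_at0 z : value_at 0 z 0.
Proof.
rewrite -tofrac0 -[X in value_at _ _ X](horner0 z); exact: value_at_poly.
Qed.

Lemma value_atC c z : value_at (ratfunC c) z c.
Proof.
rewrite -[X in value_at _ _ X](hornerC c z); exact: value_at_poly.
Qed.

Let tofrac_neq0 (b : {poly C}) z : b.[z] != 0 -> FracField.tofrac b != 0.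
Proof.
by rewrite tofrac_eq0; apply: contraNneq => ->; rewrite horner0.
Qed.

Lemma value_atM f g z u v :
  value_at f z u -> value_at g z v -> value_at (f * g) z (u * v).
Proof.
move=> [a [b [bz -> ->]]] [a' [b' [bz' -> ->]]].
exists (a * a'), (b * b'); rewrite !hornerM mulf_neq0 // !tofracM.
by rewrite !mulf_div.
Qed.

Lemma value_atD f g z u v :
  value_at f z u -> value_at g z v -> value_at (f + g) z (u + v).
Proof.
move=> [a [b [bz -> ->]]] [a' [b' [bz' -> ->]]].
exists (a * b' + a' * b), (b * b').
rewrite hornerD !hornerM mulf_neq0 // tofracD !tofracM.
have [tb tb'] := (tofrac_neq0 bz, tofrac_neq0 bz').
by rewrite (addf_div _ _ bz bz') (addf_div _ _ tb tb').
Qed.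

Lemma value_at_sum (I : finType) (f : I -> ratfun C) z (v : I -> C) :
  (forall i, value_at (f i) z (v i)) ->
  value_at (\sum_i f i) z (\sum_i v i).
Proof.
move=> fv; elim/big_ind2: _ => // [|*]; first exact: value_at0.
exact: value_atD.
Qed.

End RationalValues.

Section BasisFunctions.
Variables (C : numClosedFieldType) (n : nat) (d : iep_data C n).

(* Values at x of the basis functions as columns: the formal basis_vec for
   x = 'X, a matrix of numbers for a scalar x. *)
Definition basis_mx (F : fieldType) (f : C -> F) (x : F) : 'M[F]_(2, n) :=
  \matrix_(c, m)
    if c == pidx d m then
      match pole d m with
      | Some p => (x - f p)^-1
      | None => x ^+ infty_rank d m
      end
    else 0.

Lemma col_basis_mx m :
  col m (basis_mx (@ratfunC C) (FracField.tofrac 'X)) = basis_vec d m.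
Proof.
apply/colP => c; rewrite !mxE; case: ifP => // _.
by case: (pole d m) => [p|]; rewrite ?tofracXn // tofracB.
Qed.

Lemma value_at_basis z c m : pole d m <> Some z ->
  value_at (basis_vec d m c 0) z (basis_mx idfun z c m).
Proof.
rewrite !mxE; case: ifP => _ pz; last exact: value_at0.
case: (pole d m) pz => [p|] pz.
  rewrite -[z - p]hornerXsubC; apply: value_at_inv.
  rewrite hornerXsubC subr_eq0.
  by apply/eqP => zp; apply: pz; rewrite zp.
by rewrite -[z ^+ _]hornerXn; apply: value_at_poly.
Qed.

Lemma vec_eval_basis z (a : 'I_n -> C) :
  (forall m, pole d m <> Some z) ->
  vec_eval (\sum_m ratfunC (a m) *: basis_vec d m) z
    = basis_mx idfun z *m \col_m a m.
Proof.
move=> pz; apply/colP => c; rewrite !mxE summxE; apply: value_at_eval.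
apply: value_at_sum => m; have := value_at_basis c (pz m).
move/(value_atM (value_atC (a m) z)); rewrite [a m * _]mulrC !mxE; exact.
Qed.

Lemma infty_rank_lt (i j : 'I_n) : (i < j)%N -> pole d i = None ->
  pidx d i = pidx d j -> (infty_rank d i < infty_rank d j)%N.
Proof.
move=> ltij pi ij; apply/proper_card/properP; split.
  apply/subsetP => m; rewrite !inE ij => /and3P[mi -> ->].
  by rewrite (ltn_trans mi).
by exists i; rewrite !inE ?ltnn // ltij pi ij !eqxx.
Qed.

Lemma infty_rank_inj (i j : 'I_n) : pole d i = None -> pole d j = None ->
  pidx d i = pidx d j -> infty_rank d i = infty_rank d j -> i = j.
Proof.
move=> pi pj ij rij; apply/val_inj; case: (ltngtP i j) => // lt.
  by have := infty_rank_lt lt pi ij; rewrite rij ltnn.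
by have := infty_rank_lt lt pj (esym ij); rewrite rij ltnn.
Qed.

(** Take the last index m counted by the rank of l: the other indices counted for l are exactly
    those counted for m. *)
Lemma infty_rank_pred (l : 'I_n) : (0 < infty_rank d l)%N ->
  exists m : 'I_n, [/\ (m < l)%N, pole d m = None, pidx d m = pidx d l
    & infty_rank d l = (infty_rank d m).+1].
Proof.
case/card_gt0P => i0; set S := [set _ | _] => Si0.
case: (@arg_maxnP _ i0 (fun i => i \in S) val Si0) => m.
move=> mS max_m; have := mS; rewrite inE => /and3P[ltml /eqP pm /eqP ml].
exists m; split => //; rewrite /infty_rank -/S (cardsD1 m) mS add1n.
congr (_.+1); apply: eq_card => i; rewrite !inE ml.
apply/idP/idP => [/and4P[nim ltil pi il]|/and3P[ltim pi il]].
  rewrite pi il !andbT ltn_neqAle nim /=.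
  by apply: max_m; rewrite inE ltil pi.
rewrite pi il (ltn_trans ltim ltml) !andbT; apply: contraTneq ltim => ->.
by rewrite ltnn.
Qed.

(* v_m is the function whose product with z has v_l as its leading term
   (or as its pole part, when p_l is finite). *)
Definition shifts_to (m l : 'I_n) : Prop :=
  if pole d l is Some _ then m = l
  else [/\ (m < l)%N, pole d m = None, pidx d m = pidx d l
         & infty_rank d l = (infty_rank d m).+1].

Hypothesis n_ge2 : (2 <= n)%N.
Hypothesis first_poles : forall i : 'I_n, (i < 2)%N ->
  pole d i = None /\ pidx d i = i :> nat.

(** The index of the constant function e_c in the basis, since v_1 and v_2 are the unit vectors. *)
Definition unit_idx (c : 'I_2) : 'I_n := widen_ord n_ge2 c.

Lemma unit_idxP c : pole d (unit_idx c) = None /\ pidx d (unit_idx c) = c.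
Proof.
have [-> cE] := first_poles (ltn_ord c : (unit_idx c < 2)%N).
by split=> //; apply: val_inj.
Qed.

Lemma infty_rank_unit c : infty_rank d (unit_idx c) = 0%N.
Proof.
apply/eqP; rewrite cards_eq0 -subset0; apply/subsetP => m.
rewrite !inE => /and3P[ltmc _]; have [_ ->] := unit_idxP c => /eqP mc.
have [_ mE] := first_poles (ltn_trans ltmc (ltn_ord c)).
by move: ltmc; rewrite /= -mE mc ltnn.
Qed.

Lemma basis_mx_unit (F : fieldType) (f : C -> F) (x : F) b c :
  basis_mx f x b (unit_idx c) = (b == c)%:R.
Proof.
by rewrite mxE; have [-> ->] := unit_idxP c; rewrite infty_rank_unit; case: eqP.
Qed.

Lemma shifts_to_exists (l : 'I_n) : (2 <= l)%N -> exists m, shifts_to m l.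
Proof.
move=> l_ge2; rewrite /shifts_to; case pl: (pole d l) => [p|].
  by exists l.
apply: infty_rank_pred; apply/card_gt0P; exists (unit_idx (pidx d l)).
rewrite !inE; have [-> ->] := unit_idxP (pidx d l).
by rewrite !eqxx !andbT; apply: leq_trans (ltn_ord (pidx d l)) l_ge2.
Qed.

(** A finite pole at l gives m = l, an infinite one forces an infinite pole at m, so the two kinds
    never share m. Two infinite poles reached from m have the same component and the same rank,
    hence coincide. *)
Lemma shifts_to_inj (m l l' : 'I_n) :
  shifts_to m l -> shifts_to m l' -> l = l'.
Proof.
rewrite /shifts_to.
case pl: (pole d l) => [p|]; case pl': (pole d l') => [p'|].
- by move=> <- <-.
- by move=> -> [_]; rewrite pl.
- by move=> [_ + _ _] E; rewrite E pl'.
move=> [_ pm ml rl] [_ _ ml' rl'].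
by apply: infty_rank_inj; rewrite ?pl ?pl' ?rl ?rl' // -ml -ml'.
Qed.

(** The coordinates of z v_m when m shifts to l: z / (z - p) = 1 + p / (z - p) for a finite pole,
    the next power of z otherwise. *)
Definition shift_col (l : 'I_n) : 'cV[C]_n :=
  if pole d l is Some p then
    delta_mx (unit_idx (pidx d l)) 0 + p *: delta_mx l 0
  else delta_mx l 0.

(** Stated over any field so that it serves twice: at the nodes, for [eval_mx], and formally at x =
    'X, for the recurrence of the generated functions. *)
Lemma basis_mx_shift (F : fieldType) (f : {rmorphism C -> F}) (x : F) m l :
  shifts_to m l -> (forall p, pole d l = Some p -> x != f p) ->
  x *: col m (basis_mx f x) = basis_mx f x *m map_mx f (shift_col l).
Proof.
rewrite /shifts_to /shift_col; case pl: (pole d l) => [p|] ml px.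
  rewrite map_mxD map_mxZ !map_delta_mx mulmxDr -scalemxAr -!colE.
  apply/colP => c; rewrite [RHS]mxE [col (unit_idx _) _ _ _]mxE basis_mx_unit.
  rewrite !mxE ml pl; case: eqP => _ /=; last by rewrite !mulr0 addr0.
  have xp : x - f p != 0 by rewrite subr_eq0 px.
  by field.
case: ml => _ pm ml rl; rewrite map_delta_mx -colE; apply/colP => c.
by rewrite !mxE pm pl ml rl; case: eqP; rewrite ?mulr0 ?exprS.
Qed.

End BasisFunctions.

(** * Triangular matrices and permutations *)

(** The complements of A and of its image have the same size, so their enumerations can be matched
    term by term. *)
Lemma perm_extends (T : finType) (A : {set T}) (f : T -> T) :
  {in A &, injective f} -> exists s : {perm T}, {in A, s =1 f}.
Proof.
move=> injf; set B := ~: (f @: A).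
have cAB : #|~: A| = #|B|.
  by apply: (@addnI #|A|); rewrite cardsC -(card_in_imset injf) cardsC.
pose g x := if x \in A then f x else nth x (enum B) (index x (enum (~: A))).
have lt_index x : x \notin A -> (index x (enum (~: A)) < size (enum B))%N.
  by move=> xA; rewrite -cardE -cAB cardE index_mem mem_enum inE.
have gB x : x \notin A -> g x \in B.
  by move=> xA; rewrite /g (negPf xA) -mem_enum mem_nth ?lt_index.
have gfA x : x \in A -> g x \notin B.
  by move=> xA; rewrite /g xA inE negbK imset_f.
have injg : injective g.
  move=> x y gxy; have [xA|xA] := boolP (x \in A);
    have [yA|yA] := boolP (y \in A).
  - by move: gxy; rewrite /g xA yA; apply: injf.
  - by have := gfA x xA; rewrite gxy gB.
  - by have := gfA y yA; rewrite -gxy gB.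
  move: gxy; rewrite /g (negPf xA) (negPf yA).
  rewrite (set_nth_default y) ?lt_index // => /eqP.
  rewrite nth_uniq ?lt_index ?enum_uniq // => /eqP.
  by apply: (index_inj x); rewrite mem_enum in_setC.
by exists (perm injg) => x xA; rewrite permE /g xA.
Qed.

Section Upper.
Variable F : fieldType.

Lemma upper_eq0 n (T : 'M[F]_n) (i j : 'I_n) :
  is_trig_mx T^T -> (j < i)%N -> T i j = 0.
Proof. by move=> /is_trig_mxP/(_ j i) + ltji => /(_ ltji); rewrite mxE. Qed.

Lemma upper_diag_neq0 n (T : 'M[F]_n) (i : 'I_n) :
  is_trig_mx T^T -> T \in unitmx -> T i i != 0.
Proof.
by move=> tT uT; have := trig_mx_diag_neq0 i tT; rewrite unitmx_tr mxE; apply.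
Qed.

Lemma upper_inv n (T : 'M[F]_n) :
  is_trig_mx T^T -> T \in unitmx -> is_trig_mx (invmx T)^T.
Proof. by move=> tT uT; rewrite trmx_inv trig_mx_inv ?unitmx_tr. Qed.

(** On and below the q-th subdiagonal a single term of the double sum survives. The scaling factor
    does not depend on M, so both matrices of a pencil keep their shape and their subdiagonal
    ratios. *)
Lemma upper_mul_entry n (U M T : 'M[F]_n) q (a b : 'I_n) :
  is_trig_mx U^T -> is_trig_mx T^T ->
  (forall i j : 'I_n, (j + q < i)%N -> M i j = 0) ->
  (b + q <= a)%N -> (U *m M *m T) a b = U a a * M a b * T b b.
Proof.
move=> tU tT hM le_bq_a.
have UM (x : 'I_n) : (x <= b)%N -> (U *m M) a x = U a a * M a x.
  move=> le_xb; rewrite mxE (bigD1 a) //= big1 ?addr0 // => y nya.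
  have [lt_ya|lt_ay|eq_ya] := ltngtP y a.
  - by rewrite (upper_eq0 tU) ?mul0r.
  - rewrite hM ?mulr0 // (leq_ltn_trans _ lt_ay) //.
    by rewrite (leq_trans _ le_bq_a) // leq_add2r.
  - by rewrite (val_inj eq_ya) eqxx in nya.
rewrite mxE (bigD1 b) //= big1 ?addr0 ?UM // => x nxb.
have [lt_xb|lt_bx|eq_xb] := ltngtP x b.
- rewrite UM 1?ltnW // hM ?mulr0 ?mul0r // (leq_trans _ le_bq_a) //.
  by rewrite ltn_add2r.
- by rewrite (upper_eq0 tT) ?mulr0.
- by rewrite (val_inj eq_xb) eqxx in nxb.
Qed.

Lemma colsub_mul_upper m n k (le_kn : (k <= n)%N) (M : 'M[F]_(m, n))
    (T : 'M[F]_n) : is_trig_mx T^T ->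
  colsub (widen_ord le_kn) (M *m T) =
  colsub (widen_ord le_kn) M *m mxsub (widen_ord le_kn) (widen_ord le_kn) T.
Proof.
move=> tT; apply/matrixP => i j; rewrite !mxE (bigID (fun x : 'I_n => x < k)%N).
rewrite /= [X in _ + X]big1 ?addr0 => [|x]; last first.
  rewrite -leqNgt => le_kx; rewrite (upper_eq0 tT) ?mulr0 //=.
  exact: leq_trans (ltn_ord j) le_kx.
by rewrite (big_ord_narrow le_kn); apply: eq_bigr => x _; rewrite !mxE.
Qed.

Lemma col_mulmx m n p (A : 'M[F]_(m, n)) (B : 'M_(n, p)) j :
  col j (A *m B) = A *m col j B.
Proof. by rewrite !colE mulmxA. Qed.

Lemma mulmx_sum_cols m n (M : 'M[F]_(m, n)) (t : 'cV[F]_n) :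
  M *m t = \sum_j t j 0 *: col j M.
Proof.
apply/colP => i; rewrite mxE summxE; apply: eq_bigr => j _.
by rewrite !mxE mulrC.
Qed.

End Upper.

(** * The evaluation matrix *)

Section Data.
Variables (C : numClosedFieldType) (n : nat) (d : iep_data C n).
Hypothesis dP : is_iep_data d.

Lemma iep_data_ge2 : (2 <= n)%N. Proof. by case: dP. Qed.

Lemma iep_data_first (i : 'I_n) : (i < 2)%N ->
  pole d i = None /\ pidx d i = i :> nat.
Proof. by case: dP => _ [_ + _ _ _]; apply. Qed.

(** Coefficients at finite poles go first: multiply the relevant component by z - p and take the
    value at p. Poles with the same index are distinct, so only one term contributes. *)
Lemma basis_vec_free (a : 'I_n -> C) :
  \sum_m ratfunC (a m) *: basis_vec d m = 0 -> forall m, a m = 0.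
Proof.
move=> a0; have [_ [_ _ polesP _ _]] := dP.
have {}a0 c : \sum_m ratfunC (a m) * basis_vec d m c 0 = 0.
  have := congr1 (fun v : 'cV_2 => v c 0) a0; rewrite summxE [RHS]mxE => {2}<-.
  by apply: eq_bigr => m _; rewrite [in RHS]mxE.
have finite m p : pole d m = Some p -> a m = 0.
  move=> pm; set c := pidx d m; set x := FracField.tofrac ('X - p%:P).
  have x0 : x != 0 by rewrite tofrac_eq0 polyXsubC_eq0.
  suff val i : value_at (x * (ratfunC (a i) * basis_vec d i c 0)) p
                 (if i == m then a i else 0).
    have := value_at_eval (value_at_sum val).
    rewrite -mulr_sumr a0 mulr0 (value_at_eval (value_at0 p)) -big_mkcond /=.
    by rewrite big_pred1_eq.
  have [->|nim] := eqVneq i m.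
    rewrite mulrCA mxE eqxx pm mulfV // mulr1; exact: value_atC.
  have [ci|nci] := eqVneq c (pidx d i); last first.
    by rewrite mxE (negPf nci) !mulr0; apply: value_at0.
  have pi : pole d i <> Some p.
    move=> pi; have := polesP m i; rewrite eq_sym pm pi eqxx.
    by move/(_ nim ci isT).
  have := value_atM (value_at_poly ('X - p%:P) p)
    (value_atM (value_atC (a i) p) (value_at_basis c pi)).
  by rewrite hornerXsubC subrr mul0r.
move=> m; case pm: (pole d m) => [p|]; first exact: finite pm.
set c := pidx d m.
(* What is left of component c is a polynomial, in which distinct terms have distinct exponents. *)
pose q : {poly C} := \sum_i
  if (pole d i == None) && (c == pidx d i) then
    a i *: 'X^(infty_rank d i) else 0.
have q0 : q = 0.
  apply/eqP; rewrite -tofrac_eq0 raddf_sum -[X in _ == X](a0 c); apply/eqP.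
  apply: eq_bigr => i _; rewrite mxE; case pi: (pole d i) => [p|] /=.
    by rewrite tofrac0 (finite _ _ pi) /ratfunC tofrac0 mul0r.
  by case: eqP => _; rewrite ?tofrac0 ?mulr0 // -mul_polyC tofracM.
have := congr1 (fun q : {poly C} => q`_(infty_rank d m)) q0.
rewrite coef0 coef_sum (bigD1 m) //= pm !eqxx coefZ coefXn eqxx mulr1.
rewrite big1 ?addr0 // => i nim.
case: ifP => [/andP[/eqP pi /eqP ci]|]; last first.
  by rewrite coef0.
rewrite coefZ coefXn; case: eqP => [ri|]; last by rewrite mulr0.
by rewrite (infty_rank_inj pm pi ci ri) eqxx in nim.
Qed.

Definition eval_mx : 'M[C]_n :=
  \matrix_(i, m) ((weight d i)^t* *m col m (basis_mx d idfun (node d i))) 0 0.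

Lemma eval_mx_mul (t : 'cV[C]_n) i : (eval_mx *m t) i 0
  = ((weight d i)^t* *m (basis_mx d idfun (node d i) *m t)) 0 0.
Proof.
rewrite mulmxA [LHS]mxE [RHS]mxE; apply: eq_bigr => m _; congr (_ * _).
rewrite [LHS]mxE [LHS]mxE [RHS]mxE; apply: eq_bigr => c _; congr (_ * _).
by rewrite mxE.
Qed.

Lemma weighted_vec_eval (a : 'I_n -> C) i :
  ((weight d i)^t* *m vec_eval (\sum_m ratfunC (a m) *: basis_vec d m)
     (node d i)) 0 0 = (eval_mx *m \col_m a m) i 0.
Proof.
have [_ [_ _ _ nodeP _]] := dP.
by rewrite vec_eval_basis ?eval_mx_mul // => m; apply/eqP/nodeP.
Qed.

(** A kernel vector holds the coordinates of a function on which the positive definite form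
    vanishes. *)
Lemma eval_mx_unit : eval_mx \in unitmx.
Proof.
rewrite unitmxE unitfE -det_tr; apply/negP => /det0P[v v0 vA].
have [_ [_ _ _ _ posP]] := dP.
pose phi := \sum_m ratfunC (v 0 m) *: basis_vec d m.
have Rphi : in_Rspace d n phi.
  by exists (v 0); rewrite /phi; apply: eq_bigl => m; rewrite ltn_ord.
have phi0 : phi != 0.
  apply: contraNneq v0 => /basis_vec_free v0.
  by apply/eqP/rowP => m; rewrite v0 mxE.
have := posP phi Rphi phi0; rewrite /Rform big1 ?ltxx // => i _.
rewrite -mulmxA mxE big1 // => j _; rewrite ord1 weighted_vec_eval.
suff -> : \col_m v 0 m = v^T by rewrite -[eval_mx]trmxK -trmx_mul vA !mxE mulr0.
by apply/colP => m; rewrite !mxE.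
Qed.

Lemma eval_mx_shift (m l : 'I_n) : shifts_to d m l ->
  node_mx d *m eval_mx *m delta_mx m 0
    = eval_mx *m shift_col d iep_data_ge2 l.
Proof.
have [_ [_ _ _ nodeP _]] := dP.
move=> ml; apply/colP => i; rewrite -mulmxA mul_diag_mx mxE [X in X * _]mxE.
rewrite !eval_mx_mul -colE.
have px p : pole d l = Some p -> node d i != (idfun : {rmorphism C -> C}) p.
  by move=> pl; apply: contraTneq (nodeP i l) => ->; rewrite pl negbK.
have := basis_mx_shift iep_data_ge2 iep_data_first ml px.
rewrite (map_mx_id (f := idfun)) // => <-.
by rewrite -scalemxAr [RHS]mxE.
Qed.

Lemma shift_perm : exists s : {perm 'I_n},
  forall j l : 'I_n, l = (j + 2)%N :> nat -> shifts_to d (s j) l.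
Proof.
pose P (j m : 'I_n) := forall l : 'I_n, l = (j + 2)%N :> nat -> shifts_to d m l.
have [f fP] : exists f : 'I_n -> 'I_n, forall j, P j (f j).
  apply: fin_all_exists => j; have [ltjn|lenj] := ltnP (j + 2) n; last first.
    by exists j => l lj; move: (ltn_ord l); rewrite lj ltnNge lenj.
  have [|m ml] :=
    @shifts_to_exists _ _ _ iep_data_ge2 iep_data_first (Ordinal ltjn).
    by rewrite /= addn2.
  by exists m => l lj; rewrite (_ : l = Ordinal ltjn) //; apply: val_inj.
(* Filling the last two columns so as to obtain a permutation makes [basis_K] invertible. *)
have [s sf] : exists s : {perm 'I_n},
    {in [set j : 'I_n | (j + 2 < n)%N], s =1 f}.
  apply: perm_extends => i j; rewrite !inE => lti ltj fij.
  have := shifts_to_inj (fP i (Ordinal lti) erefl).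
  move/(_ (Ordinal ltj)); rewrite fij => /(_ (fP j (Ordinal ltj) erefl)).
  by move/(congr1 val) => /= /addIn; apply: val_inj.
exists s => j l lj; rewrite sf ?inE -?lj //; exact: fP.
Qed.

End Data.

(** * The pencil of a triangular factorization *)

Section Solution.
Variables (C : numClosedFieldType) (n : nat) (d : iep_data C n).
Hypothesis dP : is_iep_data d.
Variable s : {perm 'I_n}.
Hypothesis sP : forall j l : 'I_n, l = (j + 2)%N :> nat -> shifts_to d (s j) l.

Let n_ge2 := iep_data_ge2 dP.
Let first := iep_data_first dP.
Let unitI := unit_idx n_ge2.

(* The pencil in the basis v_1, ..., v_n: column j of basis_K picks a v_m, and
   that of basis_H expands z v_m (in the last two columns, its interpolant at
   the nodes). *)
Definition basis_K : 'M[C]_n := \matrix_(i, j) (i == s j)%:R.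
Definition basis_H : 'M[C]_n :=
  invmx (eval_mx d) *m (node_mx d *m eval_mx d *m basis_K).

Lemma basis_K_unit : basis_K \in unitmx.
Proof.
suff -> : basis_K = (perm_mx s)^T by rewrite unitmx_tr unitmx_perm.
by apply/matrixP => i j; rewrite !mxE eq_sym.
Qed.

Lemma col_basis_K j : col j basis_K = delta_mx (s j) 0.
Proof. by apply/colP => i; rewrite !mxE eqxx andbT. Qed.

Lemma col_basis_H (j l : 'I_n) : l = (j + 2)%N :> nat ->
  col j basis_H = shift_col d n_ge2 l.
Proof.
move=> lj; rewrite !col_mulmx col_basis_K (eval_mx_shift dP (sP lj)).
by rewrite mulKmx ?eval_mx_unit.
Qed.

Lemma shift_col_below (i l : 'I_n) : (2 <= l)%N -> (l < i)%N ->
  shift_col d n_ge2 l i 0 = 0.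
Proof.
move=> l_ge2 ltli; have il : (i == l) = false.
  by apply/negP => /eqP il; rewrite il ltnn in ltli.
have iu c : (i == unitI c) = false.
  apply/negP => /eqP iu; move: ltli; rewrite iu ltnNge.
  by rewrite (leq_trans _ l_ge2) // ltnW //; apply: (ltn_ord c).
rewrite /shift_col; case: (pole d l) => [p|]; rewrite !mxE ?il //.
by rewrite iu add0r mulr0.
Qed.

(** The default 1 is the leading coefficient of z v_m for an infinite pole; [basis_K] has 0 at that
    place, so the ratio is infinite. *)
Lemma shift_col_diag (l : 'I_n) : (2 <= l)%N ->
  shift_col d n_ge2 l l 0 = odflt 1 (pole d l).
Proof.
move=> l_ge2; have lu c : (l == unitI c) = false.
  by apply/negP => /eqP lu; move: l_ge2; rewrite lu leqNgt (ltn_ord c).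
rewrite /shift_col; case: (pole d l) => [p|]; rewrite !mxE !eqxx //=.
by rewrite lu add0r mulr1.
Qed.

Lemma basis_H_hessenberg : hessenberg2 basis_H.
Proof.
move=> i j ltji; have ltjn : (j + 2 < n)%N := ltn_trans ltji (ltn_ord i).
have -> : basis_H i j = col j basis_H i 0 by rewrite [RHS]mxE.
rewrite (col_basis_H (erefl : Ordinal ltjn = (j + 2)%N :> nat)).
by rewrite shift_col_below //= addn2.
Qed.

Lemma shifts_to_leq (m l : 'I_n) : shifts_to d m l -> (m <= l)%N.
Proof.
by rewrite /shifts_to; case: (pole d l) => [p ->|[/ltnW]].
Qed.

Lemma basis_K_hessenberg : hessenberg2 basis_K.
Proof.
move=> i j ltji; have ltjn : (j + 2 < n)%N := ltn_trans ltji (ltn_ord i).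
have := shifts_to_leq (sP (erefl : Ordinal ltjn = (j + 2)%N :> nat)).
rewrite mxE; case: eqP => // <- /=.
by rewrite leqNgt ltji.
Qed.

Lemma basis_K_subdiag (j l : 'I_n) : l = (j + 2)%N :> nat ->
  basis_K l j = (pole d l != None)%:R.
Proof.
move=> /sP; rewrite /shifts_to mxE; case: (pole d l) => [p ->|[lt _ _ _]].
  by rewrite eqxx.
by case: eqP => // ls; rewrite -ls ltnn in lt.
Qed.

Lemma basis_H_subdiag (j l : 'I_n) : l = (j + 2)%N :> nat ->
  basis_H l j = odflt 1 (pole d l).
Proof.
move=> lj; have -> : basis_H l j = col j basis_H l 0 by rewrite [RHS]mxE.
by rewrite (col_basis_H lj) shift_col_diag // lj addn2.
Qed.

Let V := basis_mx d (@ratfunC C) (FracField.tofrac 'X).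
Local Notation lift := (map_mx (@ratfunC C)).

(** The last two columns of [basis_H] only interpolate at the nodes, so an identity between
    functions needs t to vanish there. *)
Lemma basis_relation (t : 'cV[C]_n) :
  (forall j : 'I_n, (n <= j + 2)%N -> t j 0 = 0) ->
  FracField.tofrac 'X *: (V *m lift (basis_K *m t))
    = V *m lift (basis_H *m t).
Proof.
move=> t0; rewrite (map_mxM _ basis_K) (map_mxM _ basis_H) !mulmxA.
rewrite !mulmx_sum_cols scaler_sumr.
apply: eq_bigr => j _; have [ltjn|lenj] := ltnP (j + 2) n; last first.
  by rewrite [lift t j 0]mxE t0 // rmorph0 !scale0r scaler0.
have lj : Ordinal ltjn = (j + 2)%N :> nat by [].
rewrite scalerA mulrC -scalerA; congr (_ *: _).
rewrite !col_mulmx -!map_col (col_basis_H lj) col_basis_K map_delta_mx -colE.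
apply: basis_mx_shift => //; first exact: sP.
(* The indeterminate differs from every constant, by degree. *)
move=> p _; rewrite tofrac_eq; apply/eqP.
move/(congr1 (fun q : {poly C} => size q)).
by rewrite size_polyX size_polyC; case: (p != 0).
Qed.

Variables (Q U T : 'M[C]_n).
Hypotheses (uQ : Q \is unitarymx) (AQU : eval_mx d = Q *m U).
Hypotheses (upU : is_trig_mx U^T) (upT : is_trig_mx T^T).
Hypotheses (uU : U \in unitmx) (uT : T \in unitmx).

Let K := U *m basis_K *m T.
Let H := U *m basis_H *m T.
Let R : 'M[C]_2 := mxsub unitI unitI U.
Let R' : 'M[C]_2 := mxsub unitI unitI (invmx U).
Let phi (i : 'I_n) := V *m lift (col i (invmx U)).

(** The first two columns of the upper triangular [invmx U] vanish below row 2, so the leading block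
    of the product involves leading blocks only. *)
Lemma mul_leading_blocks : R *m R' = 1%:M.
Proof.
have := colsub_mul_upper n_ge2 U (upper_inv upU uU).
rewrite mulmxV // => /(congr1 (rowsub unitI)).
rewrite -mul_rowsub_mx => E; rewrite /R /R'.
transitivity (rowsub unitI (colsub unitI (1%:M : 'M[C]_n))).
  by rewrite [RHS]E; congr (_ *m _); apply/matrixP => a b; rewrite !mxE.
by apply/matrixP => a b; rewrite !mxE.
Qed.

(** As v_1 and v_2 are the unit vectors, W consists of the first two columns of [eval_mx d], that is
    of Q U. *)
Lemma weight_mx_factor : weight_mx d = Q *m (pid_mx 2 : 'M[C]_(n, 2)) *m R.
Proof.
have -> : Q *m (pid_mx 2 : 'M[C]_(n, 2)) = colsub unitI Q.
  apply/matrixP => i c; rewrite !mxE (bigD1 (unitI c)) //= big1.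
    by rewrite !mxE /= eqxx ltn_ord mulr1 addr0.
  move=> m nmc; rewrite mxE; case: eqP => [mc|]; rewrite ?mulr0 //.
  by case/eqP: nmc; apply: val_inj.
rewrite -(colsub_mul_upper n_ge2 Q upU) -AQU; apply/matrixP => i c.
rewrite [LHS]mxE 3!{1}[RHS]mxE (bigD1 c) //= big1 ?addr0 => [|b nbc].
  by rewrite [col _ _ _ _]mxE (basis_mx_unit n_ge2 first) eqxx mulr1.
by rewrite [col _ _ _ _]mxE (basis_mx_unit n_ge2 first) (negPf nbc) mulr0.
Qed.

Lemma phi_first (i : 'I_n) (j : 'I_2) : i = j :> nat ->
  phi i = lift (col j (invmx R)).
Proof.
move=> ij; have -> : i = unitI j by apply: val_inj.
have -> : invmx R = R'.
  have [uR _] := mulmx1_unit mul_leading_blocks.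
  by rewrite -[RHS](mulKmx uR) mul_leading_blocks mulmx1.
rewrite /phi /R'; apply/colP => c; rewrite mxE.
rewrite (bigID (fun m : 'I_n => m < 2)%N) /=.
rewrite [X in _ + X]big1 => [|m]; last first.
  rewrite -leqNgt => m_ge2; rewrite !mxE (upper_eq0 (upper_inv upU uU)).
    by rewrite rmorph0 mulr0.
  exact: leq_trans (ltn_ord j) m_ge2.
rewrite addr0 (big_ord_narrow n_ge2) (bigD1 c) //= big1 ?addr0 => [|b nbc].
  by rewrite (basis_mx_unit n_ge2 first) eqxx mul1r !mxE.
by rewrite (basis_mx_unit n_ge2 first) eq_sym (negPf nbc) mul0r.
Qed.

Lemma phi_sum i : phi i = \sum_m ratfunC (invmx U m i) *: basis_vec d m.
Proof.
rewrite /phi mulmx_sum_cols; apply: eq_bigr => m _.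
by rewrite /V col_basis_mx !mxE.
Qed.

Lemma phi_mem (i : 'I_n) : in_Rspace d i.+1 (phi i).
Proof.
exists (fun m => invmx U m i); rewrite phi_sum [RHS]big_mkcond /=.
apply: eq_bigr => m _; case: ifP => // /negbT; rewrite -leqNgt => ltim.
by rewrite (upper_eq0 (upper_inv upU uU)) // rmorph0 scale0r.
Qed.

(** The coefficient of v_i in [phi i] is a diagonal entry of the invertible triangular [invmx U],
    and coefficients are unique. *)
Lemma phi_notin (i : 'I_n) : ~ in_Rspace d i (phi i).
Proof.
move=> [b]; rewrite phi_sum [RHS]big_mkcond /= => E.
pose a m := invmx U m i - (if (m < i)%N then b m else 0).
have : \sum_m ratfunC (a m) *: basis_vec d m = 0.
  rewrite -[RHS](subrr (\sum_m ratfunC (invmx U m i) *: basis_vec d m)).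
  rewrite [in X in _ = _ - X]E -sumrB; apply: eq_bigr => m _.
  rewrite /a rmorphB scalerBl.
  by case: ifP => // _; rewrite rmorph0 scale0r.
move/(basis_vec_free dP)/(_ i); rewrite /a ltnn subr0 => /eqP.
by apply/negP/upper_diag_neq0; rewrite ?upper_inv ?unitmx_inv.
Qed.

(** The recurrence says that column j of the pencil z K - H, combined with all the phi_i, gives
    zero: the terms with i > l vanish by the Hessenberg shape. With phi = V U^-1, the factor U
    cancels and [basis_relation] remains, applied to column j of T. *)
Lemma phi_generated : generated H K R phi.
Proof.
pose P i j := FracField.tofrac (K i j *: 'X - (H i j)%:P).
split=> [|l j lj]; first exact: phi_first.
rewrite -[LHS]/(P l j *: phi l).
rewrite -[RHS]/(- \sum_(i < n | (i < l)%N) P i j *: phi i).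
have split_sum : \sum_i P i j *: phi i
    = P l j *: phi l + \sum_(i < n | (i < l)%N) P i j *: phi i.
  rewrite (bigID (fun i : 'I_n => i < l)%N) /= addrC; congr (_ + _).
  rewrite (bigD1 l) ?ltnn //= big1 ?addr0 // => i.
  rewrite -leqNgt => /andP[leli nil]; have ltji : (j + 2 < i)%N.
    by rewrite -lj ltn_neqAle eq_sym leli andbT.
  rewrite /P /K /H !(@upper_mul_entry _ _ _ _ _ 2) ?(ltnW ltji) //.
  - by rewrite basis_K_hessenberg // basis_H_hessenberg // !mulr0 !mul0r
               scale0r subrr tofrac0 scale0r.
  - exact: basis_H_hessenberg.
  - exact: basis_K_hessenberg.
apply/eqP; rewrite -addr_eq0 -split_sum; apply/eqP.
have PE i : P i j = FracField.tofrac 'X * ratfunC (K i j) - ratfunC (H i j).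
  by rewrite /P tofracB -mul_polyC tofracM mulrC.
have Phi M : \sum_i ratfunC ((U *m M *m T) i j) *: phi i
    = V *m lift (M *m col j T).
  have -> : M *m col j T = invmx U *m col j (U *m M *m T).
    by rewrite col_mulmx -!mulmxA mulKmx.
  rewrite map_mxM mulmxA mulmx_sum_cols; apply: eq_bigr => i _.
  by rewrite [lift _ _ _]mxE [col _ _ _ _]mxE col_mulmx -map_col.
under eq_bigr => i _ do rewrite PE scalerBl -scalerA.
(* Column j of T vanishes below row j, and j + 2 = l < n, so the last two columns do not enter. *)
rewrite sumrB -scaler_sumr !Phi basis_relation ?subrr // => i.
move=> len; rewrite mxE (upper_eq0 upT) //.
by move: (ltn_ord l); rewrite lj => /leq_trans/(_ len); rewrite ltn_add2r.
Qed.

Lemma triangular_solution : iep_solution d H K Q.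
Proof.
split; first split => //.
- move=> i j ltji.
  rewrite /H (upper_mul_entry upU upT basis_H_hessenberg (ltnW ltji)).
  by rewrite basis_H_hessenberg // mulr0 mul0r.
- move=> i j ltji.
  rewrite /K (upper_mul_entry upU upT basis_K_hessenberg (ltnW ltji)).
  by rewrite basis_K_hessenberg // mulr0 mul0r.
exists R; split.
- have : eval_mx d *m basis_H = node_mx d *m eval_mx d *m basis_K.
    by rewrite mulKVmx ?eval_mx_unit.
  rewrite /K /H; move: basis_H => B EB.
  by rewrite !mulmxA -(mulmxA _ Q U) -AQU EB.
- split; last exact: weight_mx_factor.
    apply/is_trig_mxP => a b ltab; rewrite !mxE; exact: upper_eq0.
  by case: (mulmx1_unit mul_leading_blocks).
- move=> l j lj; have lel : (j + 2 <= l)%N by rewrite lj.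
  rewrite /H /K (upper_mul_entry upU upT basis_H_hessenberg lel).
  rewrite (upper_mul_entry upU upT basis_K_hessenberg lel).
  rewrite basis_H_subdiag // basis_K_subdiag //.
  (* These are the common factors of numerator and denominator. *)
  have uu := upper_diag_neq0 l upU uU; have ut := upper_diag_neq0 j upT uT.
  case: (pole d l) => [p|] /=; last first.
    by rewrite mulr0 mul0r eqxx mulr1 xpair_eqE eqxx andbT mulf_neq0.
  rewrite mulr1 xpair_eqE (mulf_eq0 (U l l)) (negPf uu) (negPf ut).
  rewrite andbF; split => //.
  by congr Some; field; rewrite uu ut.
exists phi; split; first exact: phi_generated.
by move=> i; split; [apply: phi_mem|apply: phi_notin].
Qed.

End Solution.

(** * Updating by rotations *)

Section Update.
Variable C : numClosedFieldType.

(** The relation turns Q (z K - H) into (z - Z) Q K; compare determinants. *)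
Lemma regular_pencilE n (v : 'rV[C]_n) (H K Q : 'M[C]_n) :
  Q \in unitmx -> diag_mx v *m Q *m K = Q *m H ->
  (regular_pencil H K <-> K \in unitmx).
Proof.
move=> uQ QK; have dQ : \det Q != 0 by rewrite -unitfE -unitmxE.
have detE z : \det Q * \det (z *: K - H)
    = \det (z%:M - diag_mx v) * \det Q * \det K.
  rewrite -!det_mulmx; congr (\det _).
  by rewrite !mulmxBl mul_scalar_mx QK -scalemxAl mulmxBr scalemxAr.
split=> [[z dz]|].
  rewrite unitmxE unitfE; apply: contraNneq dz => dK; apply/eqP/(mulfI dQ).
  by rewrite detE dK !mulr0.
(* This z exceeds the modulus of every diagonal entry, so z - Z is invertible. *)
rewrite unitmxE unitfE => dK; pose z := 1 + \sum_i `|v 0 i|.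
exists z; rewrite -(mulrI_eq0 _ (mulfI dQ)) detE !mulf_neq0 //.
have -> : z%:M - diag_mx v = diag_mx (const_mx z - v).
  by rewrite linearB /= diag_const_mx.
rewrite det_diag; apply/prodf_neq0 => i _; rewrite !mxE subr_eq0.
apply/negP => /eqP zv; have : `|v 0 i| < z.
  rewrite /z (bigD1 i) //= addrCA ltrDl ltr_wpDr ?ltr01 //.
  by apply: sumr_ge0 => j _.
rewrite -zv ger0_norm ?ltxx // addr_ge0 ?ler01 //.
by apply: sumr_ge0 => j _.
Qed.

Lemma iep_solution_rotations n (d : iep_data C n) (A B Q : 'M[C]_n) :
  is_iep_data d -> Q \is unitarymx -> B \in unitmx ->
  node_mx d *m Q *m B = Q *m A ->
  exists QL QR : 'M[C]_n, [/\ rotation_unitary QL, rotation_unitary QR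
    & iep_solution d (QL *m A *m QR) (QL *m B *m QR) (Q *m QL^t*)].
Proof.
move=> dP uQ uB QAB; have [s sP] := shift_perm dP.
have [P [rP rP' uP]] := rotate_triangular (Q^t* *m eval_mx d).
have [U UE] : exists U, U = P *m (Q^t* *m eval_mx d) by eexists.
rewrite -UE => upU.
set Qh := Q *m P^t*; have uQh : Qh \is unitarymx.
  by rewrite mul_unitarymx ?trmxC_unitary.
have AQU : eval_mx d = Qh *m U.
  rewrite /Qh UE !mulmxA -(mulmxA Q) unitarymxPC // mulmx1.
  by move/unitarymxP: uQ => ->; rewrite mul1mx.
have uU : U \in unitmx.
  by rewrite UE !unitmx_mul unitarymx_unit // unitarymx_unit ?trmxC_unitary //
             eval_mx_unit.
set K0 := basis_K C s.
have uK0 : K0 \in unitmx := basis_K_unit C s.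
(* The target P B G = U K0 T^-1 with G unitary amounts to B^-1 P^H U K0 = G T, a QR factorization
   with G the adjoint of [P2]. *)
have [P2 [rP2 rP2' uP2]] :=
  rotate_triangular (invmx B *m P^t* *m (U *m K0)).
set T := P2 *m _ => upT.
have uT : T \in unitmx.
  rewrite unitmx_mul (unitarymx_unit uP2) unitmx_mul andbC.
  rewrite [U *m K0 \in _]unitmx_mul uU uK0 unitmx_mul unitmx_inv uB.
  rewrite unitarymx_unit //.
  by rewrite trmxC_unitary.
have KE : P *m B *m P2^t* = U *m K0 *m invmx T.
  apply: (canRL (mulmxK uT)); rewrite /T !mulmxA -(mulmxA _ _ P2).
  rewrite unitarymxPC // mulmx1 -(mulmxA _ B) mulmxV // mulmx1.
  by move/unitarymxP: uP => ->; rewrite mul1mx.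
(* The same G works for A, because A B^-1 = Q^H Z Q and [basis_H] satisfies the matching relation
   with K0. *)
have HE : P *m A *m P2^t* = U *m basis_H d s *m invmx T.
  have AE : A *m invmx B = Q^t* *m node_mx d *m Q.
    apply: (canLR (mulmxK uB)); rewrite -!mulmxA (mulmxA (node_mx d)) QAB.
    by rewrite mulmxA unitarymxPC // mul1mx.
  have : eval_mx d *m basis_H d s = node_mx d *m eval_mx d *m K0.
    by rewrite mulKVmx ?eval_mx_unit.
  move: (basis_H d s) => H0 EH; have UH : U *m H0
      = P *m Q^t* *m (node_mx d *m eval_mx d *m K0) by rewrite -EH UE !mulmxA.
  apply: (canRL (mulmxK uT)); rewrite /T !mulmxA -(mulmxA _ _ P2).
  rewrite unitarymxPC // mulmx1 -(mulmxA _ A) AE UH AQU /Qh.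
  by rewrite !mulmxA.
exists P, (P2^t*); split.
- by split.
- by split; rewrite ?trmxCK ?trmxC_unitary.
rewrite KE HE; apply: triangular_solution => //; last by rewrite unitmx_inv.
exact: upper_inv.
Qed.

End Update.

Lemma snoc_fun_lshift T n (f : 'I_n -> T) x i :
  snoc_fun f x (lshift 1 i) = f i.
Proof. by rewrite /snoc_fun -[lshift 1 i]/(unsplit (inl i)) unsplitK. Qed.

Lemma snoc_fun_rshift T n (f : 'I_n -> T) x i :
  snoc_fun f x (rshift n i) = x.
Proof. by rewrite /snoc_fun -[rshift n i]/(unsplit (inr i)) unsplitK. Qed.

Theorem theorem3p4 (R : realType) (k : nat) (d : iep_data R[i] k)
    (H K Q : 'M[R[i]]_k)
    (znew : R[i]) (wnew : 'cV[R[i]]_2) (pnew : option R[i]) (pinew : 'I_2) :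
  (2 <= k)%N ->
  is_iep_data d ->
  iep_solution d H K Q ->
  regular_pencil H K ->
  is_iep_data (iep_extend d znew wnew pnew pinew) ->
  exists Hh Kh Qh : 'M[R[i]]_(k + 1),
    [/\ iep_solution (iep_extend d znew wnew pnew pinew) Hh Kh Qh,
        regular_pencil Hh Kh
      & exists QL QR : 'M[R[i]]_(k + 1),
        [/\ rotation_product QL, rotation_product QR,
            Hh = QL *m block_mx H 0 0 znew%:M *m QR,
            Kh = QL *m block_mx K 0 0 1%:M *m QR
          & Qh = block_mx Q 0 0 1%:M *m QL^t*]].
Proof.
move=> _ _ [[_ _ uQ] [R0 [QK _ _ _]]] regHK dP.
have uK : K \in unitmx.
  exact/(regular_pencilE (unitarymx_unit uQ) QK).
set d' := iep_extend _ _ _ _ _ in dP *.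
set A := block_mx H 0 0 _; set B := block_mx K 0 0 _.
set Q1 := block_mx Q 0 0 _.
have uQ1 : Q1 \is unitarymx by rewrite unitarymx_block ?unitarymx1.
have uB : B \in unitmx by rewrite unitmxE det_ublock det1 mulr1 -unitmxE.
have nodeE : node_mx d' = block_mx (node_mx d) 0 0 znew%:M.
  apply/matrixP => i j; rewrite mxE [(\row__ _) _ _]mxE /=.
  case: (split_ordP i) => a ->; case: (split_ordP j) => b ->;
    rewrite ?snoc_fun_lshift ?snoc_fun_rshift.
  - by rewrite block_mxEul !mxE (inj_eq (@lshift_inj _ _)).
  - by rewrite block_mxEur !mxE eq_lrshift.
  - by rewrite block_mxEdl !mxE eq_rlshift.
  - by rewrite block_mxEdr !mxE (inj_eq (@rshift_inj _ _)).
have QAB : node_mx d' *m Q1 *m B = Q1 *m A.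
  rewrite nodeE !mulmx_block !mul0mx !mulmx0 !addr0 !add0r QK.
  by rewrite !mulmx1 !mul0mx mul1mx.
have [QL [QR [[rL _ uL] [rR _ uR] sol]]] :=
  iep_solution_rotations dP uQ1 uB QAB.
exists (QL *m A *m QR), (QL *m B *m QR), (Q1 *m QL^t*); split => //.
  have [[_ _ uQh] [R1 [QKh _ _ _]]] := sol.
  apply/(regular_pencilE (unitarymx_unit uQh) QKh).
  (* The new K differs from the invertible B by unitary factors. *)
  by rewrite !unitmx_mul uB !unitarymx_unit.
by exists QL, QR.
Qed.
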